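(* Every circularly ordered compact metrizable cascade $(\mathbb{Z},X)$ is null, and hence is also tame.
   Context: A circular order on a set $X$ is a relation $R\subset X^3$ (write $[a,b,c]$ for $(a,b,c)\in R$) such that: $[a,b,c]\Rightarrow[b,c,a]$; $[a,b,c]\Rightarrow (a,c,b)\notin R$; $[a,b,c]$ and $[a,c,d]$ imply $[a,b,d]$; if $a,b,c$ are distinct then $[a,b,c]$ or $[a,c,b]$. For $a\ne b$ put $(a,b)_R=\{x:[a,x,b]\}$ and $[a,b]_R=(a,b)_R\cup\{a,b\}$; put $[a,a]_R=\{a\}$. The interval topology $\tau_R$ has the sets $(a,b)_R$ as a base (if $|X|\le2$ take the discrete topology). A map $f$ between circularly ordered sets is c-order preserving (COP) if (1) $[a,b,c]$ and $f(a),f(b),f(c)$ distinct imply $[f(a),f(b),f(c)]$; and (2) $f(a)=f(c)$ implies $f$ is constant on one of $[a,c]_R$, $[c,a]_R$. A cascade is a continuous action of $G=\mathbb{Z}$ on a compact Hausdorff space $X$. It is circularly ordered if there is a circular order $R$ on $X$ such that $\tau_R$ is the topology of $X$ and every translation $x\mapsto gx$, $g\in\mathbb{Z}$, is COP. For an open cover $\mathcal{U}$ let $N(\mathcal{U})$ be the minimal cardinality of a subcover. For a sequence $A=\{a_0,a_1,\dots\}$ of elements of $G$ put $$h^A_{top}(X,\mathcal{U})=\limsup_{n\to\infty}\frac1n\log N\Big(\bigvee_{i=0}^{n-1}a_i^{-1}(\mathcal{U})\Big),\qquad h^A_{top}(G,X)=\sup_{\mathcal{U}}h^A_{top}(X,\mathcal{U}),$$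 the supremum being over all open covers of $X$ (here $\bigvee$ denotes the common refinement of covers). The system $(G,X)$ is null if $h^A_{top}(G,X)=0$ for every sequence $A\subset G$. A sequence $f_n:X\to\mathbb{R}$ is independent if there are reals $a<b$ such that $\bigcap_{n\in P}f_n^{-1}(-\infty,a)\cap\bigcap_{n\in M}f_n^{-1}(b,\infty)\ne\emptyset$ for all finite disjoint $P,M\subset\mathbb{N}$. A compact system $(G,X)$ is tame if for every continuous $f:X\to\mathbb{R}$ the family $\{x\mapsto f(gx):g\in G\}$ contains no independent sequence. *)

(* Defs.v *)
From mathcomp Require Import all_boot all_order all_algebra.
From mathcomp Require Import all_classical all_reals all_analysis.

Set Implicit Arguments.
Unset Strict Implicit.
Unset Printing Implicit Defensive.

Import Order.TTheory GRing.Theory Num.Theory.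
Import numFieldNormedType.Exports.

Local Open Scope classical_set_scope.
Local Open Scope card_scope.
Local Open Scope ring_scope.

Definition circular_order (X : Type) (Ro : X -> X -> X -> Prop) : Prop :=
  [/\ forall a b c, Ro a b c -> Ro b c a,
      forall a b c, Ro a b c -> ~ Ro a c b,
      forall a b c d, Ro a b c -> Ro a c d -> Ro a b d
    & forall a b c, a <> b -> b <> c -> a <> c -> Ro a b c \/ Ro a c b].

Definition cint_oo (X : Type) (Ro : X -> X -> X -> Prop) (a b : X) : set X :=
  [set x | Ro a x b].

Definition cint_cc (X : eqType) (Ro : X -> X -> X -> Prop) (a b : X) : set X :=
  if a == b then [set a] else cint_oo Ro a b `|` [set a; b].

Definition is_interval_topology (X : topologicalType)
    (Ro : X -> X -> X -> Prop) : Prop :=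
  if [set: X] #<= `I_2 then forall A : set X, open A
  else basis [set A | exists a b : X, a <> b /\ A = cint_oo Ro a b].

Definition constant_on (X Y : Type) (A : set X) (f : X -> Y) : Prop :=
  forall x y, A x -> A y -> f x = f y.

Definition c_order_preserving (X : eqType) (Y : Type)
    (RX : X -> X -> X -> Prop) (RY : Y -> Y -> Y -> Prop) (f : X -> Y) : Prop :=
  (forall a b c, RX a b c -> f a <> f b -> f b <> f c -> f a <> f c ->
     RY (f a) (f b) (f c)) /\
  (forall a c, f a = f c ->
     constant_on (cint_cc RX a c) f \/ constant_on (cint_cc RX c a) f).

(* [discrete_topology] makes joint continuity on Z * X refer to the discrete
   topology of Z. *)
Definition is_cascade (X : topologicalType) (T : int -> X -> X) : Prop :=
  [/\ compact [set: X], hausdorff_space X,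
      forall x, T 0 x = x,
      forall g h x, T (g + h) x = T g (T h x)
    & continuous (fun p : discrete_topology int * X => T p.1 p.2)].

Definition circularly_ordered (X : topologicalType) (T : int -> X -> X) : Prop :=
  exists Ro : X -> X -> X -> Prop,
    [/\ circular_order Ro, is_interval_topology Ro
      & forall g, c_order_preserving Ro Ro (T g)].

Definition metrizable (R : realType) (X : topologicalType) : Prop :=
  exists d : X -> X -> R,
    [/\ forall x y, d x y = 0 <-> x = y,
        forall x y, d x y = d y x,
        forall x y z, d x z <= d x y + d y z
      & forall x (A : set X),
          nbhs x A <-> exists2 e : R, 0 < e & [set y | d x y < e] `<=` A].

Definition open_cover (X : topologicalType) (U : set (set X)) : Prop :=
  U `<=` open /\ \bigcup_(A in U) A = setT.

Definition subcover (X : Type) (U V : set (set X)) : Prop :=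
  V `<=` U /\ \bigcup_(A in V) A = setT.

Definition has_subcover_of_card (X : Type) (U : set (set X)) (n : nat) : Prop :=
  exists2 V, subcover U V & V #= `I_n.

(* The value is 0 when there is no finite subcover; this does not happen for
   open covers of a compact space. *)
Definition subcover_number (X : Type) (U : set (set X)) : nat :=
  xget 0%N [set n | has_subcover_of_card U n /\
    forall m, has_subcover_of_card U m -> (n <= m)%N].

Definition cover_join (X : Type) (n : nat) (C : nat -> set (set X)) :
    set (set X) :=
  [set \bigcap_(i in `I_n) V i | V in
    [set V : nat -> set X | forall i, (i < n)%N -> C i (V i)]].

Definition preimage_cover (X : Type) (f : X -> X) (U : set (set X)) :
    set (set X) :=
  [set f @^-1` A | A in U].

(* The term at n = 0 is a junk value, irrelevant for the limsup. *)
Definition cover_seq_entropy (R : realType) (X : Type) (T : int -> X -> X)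
    (a : nat -> int) (U : set (set X)) : \bar R :=
  limn_esup (fun n : nat =>
    (n%:R^-1 * ln (subcover_number
       (cover_join n (fun i => preimage_cover (T (a i)) U)))%:R : R)%:E).

Definition seq_entropy (R : realType) (X : topologicalType)
    (T : int -> X -> X) (a : nat -> int) : \bar R :=
  ereal_sup [set cover_seq_entropy R T a U | U in @open_cover X].

Definition null_system (R : realType) (X : topologicalType)
    (T : int -> X -> X) : Prop :=
  forall a : nat -> int, seq_entropy R T a = 0%E.

Definition independent_seq (R : realType) (X : Type) (f : nat -> X -> R) :
    Prop :=
  exists a b : R, a < b /\
    forall P M : set nat, finite_set P -> finite_set M -> P `&` M = set0 ->
      (\bigcap_(n in P) (f n @^-1` [set y | y < a]) `&`
       \bigcap_(n in M) (f n @^-1` [set y | b < y])) !=set0.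

Definition tame_system (R : realType) (X : topologicalType)
    (T : int -> X -> X) : Prop :=
  forall f : X -> R, continuous f ->
    ~ exists u : nat -> X -> R,
        (forall n, exists g : int, u n = f \o T g) /\ independent_seq u.

(* Main.v *)
Require Import Defs.
From mathcomp Require Import all_boot all_order all_algebra.
From mathcomp Require Import all_classical all_reals all_analysis.
From mathcomp Require Import zify lra.

(** Fix a finite cover of a circularly ordered space by intervals subordinate
    to an open cover [U], and let [F] be the finite set of their endpoints.
    Two points that are not separated by [F] lie in the same intervals, hence
    in a common member of [U] ([finite_separating_set]).  Translations by
    elements of the group are bijective, so they are automorphisms of the
    circular order ([translation_circular]); points not separated by
    [F_n], the union of the sets [T (- g i) F] for [i < n], therefore have
    their [T (g i)]-translates in a common member of [U] for every [i < n].

    A set of [m] points of a circle cuts it into at most [2 m] cells, the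
    points and the gaps between them.  To count cells, cut the circle at one
    of the points: what remains is a linear order, and the cell of [x] is
    determined by the number of points below [x] plus the number of points
    weakly below [x] ([cell_code_inj]).  As [F_n] has at most [n |F|] points,
    the [n]-th refinement of [U] along the sequence [g] has a subcover with
    [O(n)] members ([itinerary_code], [subcover_number_le]), and
    [log (O(n)) / n] tends to [0].

    Tameness follows from the same linear bound.  If the functions
    [f \o T (g i)] were independent with thresholds [a < b], then the [2 ^ n]
    patterns of being below [a] or above [b] at the times [i < n] would be
    realized by points in pairwise different cells for the cover
    [{f < b}, {a < f}]; but [2 ^ n] exceeds [O(n)]. *)

Set Implicit Arguments.
Unset Strict Implicit.
Unset Printing Implicit Defensive.

Import Order.TTheory GRing.Theory Num.Theory.
Import numFieldNormedType.Exports.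

Local Open Scope classical_set_scope.
Local Open Scope ring_scope.

(** * Cutting a circular order into a linear order *)

(** The linear order obtained by cutting the circle at [p], which becomes the
    least element. *)
Definition cut (X : Type) (Ro : X -> X -> X -> Prop) (p a b : X) : Prop :=
  (a = p /\ b <> p) \/ Ro p a b.

Lemma circular_neq (X : Type) (Ro : X -> X -> X -> Prop) (a b c : X) :
  circular_order Ro -> Ro a b c -> [/\ a <> b, b <> c & a <> c].
Proof.
move=> [rot asym _ _] abc; split=> e; subst.
- exact: (asym _ _ _ abc) (rot _ _ _ abc).
- exact: (asym _ _ _ abc) abc.
- exact: (asym _ _ _ (rot _ _ _ abc)) (rot _ _ _ abc).
Qed.

Lemma cut_irr (X : Type) (Ro : X -> X -> X -> Prop) (p a : X) :
  circular_order Ro -> ~ cut Ro p a a.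
Proof. by move=> co [[]//|/(circular_neq co)[_ /(_ erefl)]]. Qed.

Lemma cut_trans (X : Type) (Ro : X -> X -> X -> Prop) (p a b c : X) :
  circular_order Ro -> cut Ro p a b -> cut Ro p b c -> cut Ro p a c.
Proof.
move=> co; have [rot asym tr _] := co.
case=> [[-> bp]|pab] [[// bp' _]|pbc].
- by left; split=> // cp; have [_ _] := circular_neq co pbc; rewrite cp.
- by have [_ _] := circular_neq co pab; rewrite bp'.
- by right; exact: tr pab pbc.
Qed.

Lemma cut_total (X : Type) (Ro : X -> X -> X -> Prop) (p a b : X) :
  circular_order Ro -> a <> b -> cut Ro p a b \/ cut Ro p b a.
Proof.
move=> [_ _ _ tot] ab.
have [ap|ap] := pselect (a = p); first by left; left; split=> //; congruence.
have [bp|bp] := pselect (b = p); first by right; left.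
have [|||H|H] := tot p a b; [congruence|congruence|congruence| |].
  by left; right.
by right; right.
Qed.

Lemma cut_circular (X : Type) (Ro : X -> X -> X -> Prop) (p a b c : X) :
  circular_order Ro -> cut Ro p a b -> cut Ro p b c -> Ro a b c.
Proof.
move=> co; have [rot asym tr _] := co.
case=> [[-> bp]|pab] [[// bp' _]|pbc] //.
  by have [_ _] := circular_neq co pab; rewrite bp'.
(* Seen from [b], the points occur in the order [c, p, a]. *)
have bpa : Ro b p a := rot _ _ _ (rot _ _ _ pab).
have bcp : Ro b c p := rot _ _ _ pbc.
exact: (rot _ _ _ (rot _ _ _ (tr _ _ _ _ bcp bpa))).
Qed.

(** A circular triple is, up to rotation, a chain of the cut order; the three
    remaining arrangements give the opposite triple. *)
Lemma circularE (X : Type) (Ro : X -> X -> X -> Prop) (p a b c : X) :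
  circular_order Ro ->
  Ro a b c <-> [\/ cut Ro p a b /\ cut Ro p b c,
                  cut Ro p b c /\ cut Ro p c a
                | cut Ro p c a /\ cut Ro p a b].
Proof.
move=> co; have [rot asym _ _] := co; split; last first.
  case=> -[h1 h2]; have := cut_circular co h1 h2 => //.
    by move=> /rot/rot.
  by move=> /rot.
move=> abc; have [ab bc ac] := circular_neq co abc.
have nacb := asym _ _ _ abc.
have [h1|h1] := cut_total p co ab; have [h2|h2] := cut_total p co bc;
  have [h3|h3] := cut_total p co ac;
  try by [constructor 1|constructor 2|constructor 3].
- by case: nacb; exact: (cut_circular co h3 h2).
- by case: nacb; exact: (rot _ _ _ (cut_circular co h1 h3)).
- by case: nacb; exact: (rot _ _ _ (rot _ _ _ (cut_circular co h2 h1))).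
- by case: nacb; exact: (rot _ _ _ (rot _ _ _ (cut_circular co h2 h1))).
Qed.

(** * Cells of a finite set *)

(** The singletons matter only for spaces with at most two points, where all
    intervals are empty; there they stand for the discrete topology. *)
Definition unseparated (X : eqType) (Ro : X -> X -> X -> Prop) (F : seq X)
    (x y : X) : Prop :=
  (forall a b, a \in F -> b \in F -> Ro a x b -> Ro a y b) /\
  (forall a, a \in F -> x = a -> y = a).

(** In the order cut at the head of [F], the points and gaps of [F] form an
    increasing sequence of cells, along which the code increases strictly.
    The condition [~ cut Ro p x a] says that [a] is weakly below [x]. *)
Definition cell_code (X : Type) (Ro : X -> X -> X -> Prop) (F : seq X)
    (x : X) : nat :=
  if F is p :: _ then
    (count (fun a => `[< cut Ro p a x >]) F +
     count (fun a => `[< ~ cut Ro p x a >]) F)%N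
  else 0%N.

Lemma cell_code_le (X : Type) (Ro : X -> X -> X -> Prop) (F : seq X) (x : X) :
  (cell_code Ro F x <= 2 * size F)%N.
Proof.
case: F => [//|p F]; rewrite /cell_code mul2n -addnn.
by apply: leq_add; exact: count_size.
Qed.

Lemma sub_count_eq (T : eqType) (a1 a2 : pred T) (s : seq T) :
  subpred a1 a2 -> (count a2 s <= count a1 s)%N -> {in s, a1 =1 a2}.
Proof.
move=> sub le x xs; apply/idP/idP => [/sub//|a2x]; apply: contraT => a1x.
have cU : count (predU a1 (pred1 x)) s = (count a1 s + count_mem x s)%N.
  rewrite -count_predUI [X in (_ + X)%N](_ : _ = 0%N) ?addn0//.
  apply/eqP; rewrite -leqn0 leqNgt -has_count -all_predC; apply/allP => y _ /=.
  by apply/negP => /andP[a1y /eqP yx]; rewrite yx (negbTE a1x) in a1y.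
have : (0 < count_mem x s)%N by rewrite -has_count has_pred1.
suff: (count a1 s + count_mem x s <= count a2 s)%N by lia.
by rewrite -cU; apply: sub_count => y /= /orP[/sub//|/eqP->].
Qed.

(** If [x] is below [y], then what is below [x], or weakly below it, is so for
    [y]; both counts are monotone, so equality of the sums forces each point of
    [F] to be placed in the same way relative to [x] and to [y]. *)
Lemma cell_code_cut (X : eqType) (Ro : X -> X -> X -> Prop) (p : X)
    (F : seq X) (x y : X) :
  circular_order Ro -> cut Ro p x y ->
  cell_code Ro (p :: F) x = cell_code Ro (p :: F) y ->
  {in p :: F, forall a, (cut Ro p a x <-> cut Ro p a y) /\
                        (cut Ro p x a <-> cut Ro p y a)}.
Proof.
set F' := p :: F => co xy.
pose A z := count (fun a => `[< cut Ro p a z >]) F'.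
pose B z := count (fun a => `[< ~ cut Ro p z a >]) F'.
rewrite -[cell_code _ _ x]/(A x + B x)%N -[cell_code _ _ y]/(A y + B y)%N => e.
have sA : subpred (fun a => `[< cut Ro p a x >]) (fun a => `[< cut Ro p a y >]).
  by move=> a /asboolP ax; apply/asboolP; exact: cut_trans xy.
have sB : subpred (fun a => `[< ~ cut Ro p x a >])
                  (fun a => `[< ~ cut Ro p y a >]).
  move=> a /asboolP ax; apply/asboolP => ya; apply: ax; exact: cut_trans xy ya.
have lA : (A x <= A y)%N := sub_count sA F'.
have lB : (B x <= B y)%N := sub_count sB F'.
have eA := sub_count_eq sA (_ : A y <= A x)%N.
have eB := sub_count_eq sB (_ : B y <= B x)%N.
move=> a aF; split.
  by apply: asbool_eq_equiv; apply: eA => //; lia.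
apply/iff_not2; apply: asbool_eq_equiv; apply: eB => //; lia.
Qed.

Lemma cell_code_inj (X : eqType) (Ro : X -> X -> X -> Prop) (F : seq X)
    (x y : X) :
  circular_order Ro -> cell_code Ro F x = cell_code Ro F y ->
  unseparated Ro F x y.
Proof.
move=> co; case: F => [//|p F] e.
have [->|/eqP xy] := eqVneq x y; first by split.
have same : {in p :: F, forall a, (cut Ro p a x <-> cut Ro p a y) /\
                                  (cut Ro p x a <-> cut Ro p y a)}.
  have [xy'|yx] := cut_total p co xy; first exact: cell_code_cut.
  by move=> a /(cell_code_cut co yx (esym e))[-> ->].
split=> [a b aF bF|a aF xa].
  have [/propext a1 /propext a2] := same a aF.
  have [/propext b1 /propext b2] := same b bF.
  by move=> /(circularE p _ _ _ co); rewrite a1 b2 => /(circularE p _ _ _ co).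
have [a1 a2] := same a aF; apply: contrapT => ya.
by case: (cut_total p co ya) => [/a2|/a1]; rewrite xa; exact: cut_irr.
Qed.

(** * Finite separating sets and translations *)

(** Compactness in its filter form: the family of finite sets, directed by
    inclusion, eventually works at every point because it eventually works
    near each of them. *)
Lemma finite_separating_set (X : topologicalType) (Ro : X -> X -> X -> Prop)
    (U : set (set X)) :
  compact [set: X] -> is_interval_topology Ro -> open_cover U ->
  exists F : seq X,
    forall x, exists2 A, U A & forall y, unseparated Ro F x y -> A y.
Proof.
move=> /compact_near_coveringP cX itop [Uop Ucov].
pose P (F : seq X) x :=
  exists2 A, U A & forall y, unseparated Ro F x y -> A y.
have Pmono (F F' : seq X) x : {subset F <= F'} -> P F x -> P F' x.
  move=> FF' [A UA FA]; exists A => // y [sep1 sep2]; apply: FA; split.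
    by move=> a b aF bF; apply: sep1; exact: FF'.
  by move=> a aF; apply: sep2; exact: FF'.
have Ploc (x : X) : exists2 F, True & nbhs x (P F).
  have [A UA Ax] : (\bigcup_(A in U) A) x by rewrite Ucov.
  move: itop; rewrite /is_interval_topology; case: ifP => _.
    move=> disc; exists [:: x] => //.
    have : nbhs x [set x] by exact: open_nbhs_nbhs.
    apply: filterS => _ ->; exists A => // y [_ /(_ x)].
    by rewrite inE eqxx => /(_ erefl erefl) ->.
  move=> [Bop /(_ x A)] /=.
  have Anx : nbhs x A by apply: open_nbhs_nbhs; split=> //; exact: Uop.
  move=> /(_ Anx)[_ [[a [b [ab ->]]] abx] abA].
  exists [:: a; b] => //.
  have : nbhs x (cint_oo Ro a b).
    by apply: open_nbhs_nbhs; split=> //; apply: Bop; exists a, b.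
  apply: filterS => z abz; exists A => // y [/(_ a b) sep _]; apply: abA.
  by apply: sep abz; rewrite !inE eqxx ?orbT.
pose larger := filter_from [set: seq X]
  (fun F => [set F' : seq X | {subset F <= F'}]).
have larger_filter : Filter larger.
  apply: filter_from_filter; first by exists [::].
  move=> F G _ _; exists (F ++ G) => // H FGH; split=> z zF; apply: FGH.
    by rewrite mem_cat zF.
  by rewrite mem_cat zF orbT.
have [F _ FP] : \forall F \near larger, [set: X] `<=` P F.
  apply: cX => x _; have [F _ xP] := Ploc x.
  exists (P F, [set F' : seq X | {subset F <= F'}]) => /=.
    by split=> //; exists F.
  by move=> [y F'] /= [Py FF']; exact: Pmono Py.
by exists F => x; exact: (FP F).
Qed.

(** A translation is injective, having an inverse translation, so it keeps
    the points of a circular triple distinct. *)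
Lemma translation_circular (X : topologicalType) (T : int -> X -> X)
    (Ro : X -> X -> X -> Prop) (g : int) (a b c : X) :
  is_cascade T -> circular_order Ro -> c_order_preserving Ro Ro (T g) ->
  Ro a b c -> Ro (T g a) (T g b) (T g c).
Proof.
move=> [_ _ T0 TD _] co [cop _] abc; have [ab bc ac] := circular_neq co abc.
have inj : injective (T g).
  by move=> x y /(congr1 (T (- g))); rewrite -!TD addNr !T0.
by apply: cop abc _ _ _ => /inj.
Qed.

(** The code of [x] identifies its cell for the union of the sets
    [T (- g i) F], where [F] separates points up to [U]. *)
Lemma itinerary_code (X : topologicalType) (T : int -> X -> X)
    (U : set (set X)) :
  is_cascade T -> circularly_ordered T -> open_cover U ->
  exists C : nat, forall (n : nat) (g : nat -> int),
    exists2 code : X -> nat, (forall x, code x <= C * n)%N &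
      forall x i, (i < n)%N ->
        exists2 A, U A & forall y, code y = code x -> A (T (g i) y).
Proof.
move=> hT [Ro [co itop cop]] Ucov; have [cX _ T0 TD _] := hT.
have [F FU] := finite_separating_set cX itop Ucov.
exists (2 * size F)%N => n g.
pose Fn := [seq T (- g i) z | i <- iota 0 n, z <- F].
exists (cell_code Ro Fn) => [x|x i ni].
  by have := cell_code_le Ro Fn x; rewrite size_allpairs size_iota; lia.
have [A UA xA] := FU (T (g i) x); exists A => // y yx; apply: xA.
have inFn a : a \in F -> T (- g i) a \in Fn.
  by move=> aF; apply: allpairs_f => //; rewrite mem_iota.
have TK a : T (g i) (T (- g i) a) = a by rewrite -TD addrN T0.
have TK' a : T (- g i) (T (g i) a) = a by rewrite -TD addNr T0.
have [sep1 sep2] := cell_code_inj co (esym yx); split=> [a b aF bF axb|a aF xa].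
  have := translation_circular hT co (cop (- g i)) axb; rewrite TK'.
  move=> /(sep1 _ _ (inFn a aF) (inFn b bF)).
  by move=> /(translation_circular hT co (cop (g i))); rewrite !TK.
by rewrite (sep2 _ (inFn a aF)) ?TK// -xa TK'.
Qed.

(** * Linear growth of the refined covers *)

Lemma subcover_number_min (X : Type) (U : set (set X)) (n : nat) :
  has_subcover_of_card U n -> (subcover_number U <= n)%N.
Proof.
by move=> Un; rewrite /subcover_number; case: xgetP => [m _ [_ /(_ n Un)]|].
Qed.

Lemma subcover_number_le (X : Type) (T : int -> X -> X)
    (U : set (set X)) (n m : nat) (g : nat -> int) (code : X -> nat) :
  (forall x, code x <= m)%N ->
  (forall x i, (i < n)%N ->
     exists2 A, U A & forall y, code y = code x -> A (T (g i) y)) ->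
  (subcover_number
     (cover_join n (fun i => preimage_cover (T (g i)) U)) <= m.+1)%N.
Proof.
move=> codem codeU.
have choose c : exists A : nat -> set X, forall x, code x = c ->
    forall i, (i < n)%N -> U (A i) /\ A i (T (g i) x).
  have [[x xc]|nx] := pselect (exists x, code x = c); last first.
    by exists (fun=> setT) => x xc; case: nx; exists x.
  have /choice[A AP] : forall i, exists A, (i < n)%N ->
      U A /\ forall y, code y = code x -> A (T (g i) y).
    move=> i; case: (ltnP i n) => [ni|_]; last by exists setT.
    by have [A UA xA] := codeU x i ni; exists A.
  exists A => y yc i ni; have [UA xA] := AP i ni.
  by split=> //; apply: xA; rewrite yc.
have [A AP] := choice choose.
pose W c := \bigcap_(i in `I_n) (T (g i) @^-1` (A c i)).
have leW : (W @` range code #<= `I_m.+1)%card.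
  apply: card_le_trans (card_image_le _ _) _.
  by apply: subset_card_le => _ [x _ <-]; rewrite /= ltnS.
have /finite_setP[k Wk] := card_le_finite leW (finite_II _).
have km : (k <= m.+1)%N.
  by rewrite -card_le_II -(card_le_eql Wk).
apply: leq_trans km; apply: subcover_number_min; exists (W @` range code) => //.
split=> [_ [_ [x _ <-] <-]|].
  exists (fun i => T (g i) @^-1` (A (code x) i)) => // i ni.
  by exists (A (code x) i) => //; have [] := AP _ x erefl i ni.
rewrite -subTset => x _; exists (W (code x)).
  by exists (code x) => //; exists x.
by move=> i /= ni; have [] := AP _ x erefl i ni.
Qed.

(** From [ln x = 2 * ln (sqrt x) <= 2 * sqrt x] it follows that the quotient
    is [O(1 / sqrt n)]. *)
Lemma cvg_ln_linear_growth (R : realType) (N : nat -> nat) (C : nat) :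
  (forall n, N n <= (C * n).+1)%N ->
  (n%:R^-1 * ln (N n)%:R : R) @[n --> \oo] --> (0 : R).
Proof.
move=> NC.
have ln_sqrt (k : nat) : ln (k%:R : R) <= 2 * Num.sqrt k%:R.
  case: k => [|k]; first by rewrite ln0// mulr_ge0.
  have k0 : 0 < Num.sqrt (k.+1%:R : R) by rewrite sqrtr_gt0 ltr0n.
  rewrite -{1}(@sqr_sqrtr _ k.+1%:R) ?ler0n// lnXn//.
  rewrite -[ln _ *+ _]mulr_natl ler_pM2l//.
  exact: ltW (ln_sublinear k0).
have ln_nat_ge0 (k : nat) : 0 <= ln (k%:R : R).
  by case: k => [|k]; [rewrite ln0|rewrite ln_ge0// ler1n].
rewrite -cvg_shiftS.
have upper : 2 * Num.sqrt (C.+1%:R * @harmonic R n) @[n --> \oo] --> (0 : R).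
  rewrite -[X in _ --> X](_ : 2 * Num.sqrt (C.+1%:R * 0) = 0 :> R); last first.
    by rewrite mulr0 sqrtr0 mulr0.
  apply: cvgMr; apply: (continuous_cvg _ (@sqrt_continuous R _)).
  by apply: cvgMr; exact: cvg_harmonic.
apply: (squeeze_cvgr _ (cvg_cst 0) upper); apply: nearW => n.
rewrite mulr_ge0 ?invr_ge0 ?ler0n//=.
rewrite /harmonic /=; set h : R := _^-1.
have h0 : 0 <= h by rewrite invr_ge0 ler0n.
apply: le_trans (ler_wpM2l h0 (ln_sqrt _)) _.
rewrite mulrCA ler_pM2l// -{1}(ger0_norm h0) -sqrtr_sqr -sqrtrM ?sqr_ge0//.
rewrite ler_sqrt ?mulr_ge0 ?ler0n// mulrC expr2 mulrA ler_wpM2r//.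
rewrite ler_pdivrMr ?ltr0n// -natrM ler_nat.
by apply: leq_trans (NC n.+1) _; lia.
Qed.

Lemma circularly_ordered_null (R : realType) (X : topologicalType)
    (T : int -> X -> X) :
  is_cascade T -> circularly_ordered T -> null_system R T.
Proof.
move=> hT hco g.
have entropy0 U : open_cover U -> cover_seq_entropy R T g U = 0%E.
  move=> Ucov; have [C CU] := itinerary_code hT hco Ucov.
  apply: (cvg_limn_einf_sup _).2; apply/cvg_EFin; first exact: nearW.
  apply: (@cvg_ln_linear_growth R _ C) => n.
  have [code code_le codeU] := CU n g; exact: subcover_number_le codeU.
rewrite /seq_entropy; apply/eqP; rewrite eq_le; apply/andP; split.
  by apply: ge_ereal_sup => _ [U Ucov <-]; rewrite entropy0.
have trivial_cover : open_cover [set [set: X]].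
  by split; [move=> _ ->; exact: openT|rewrite bigcup_set1].
rewrite -(entropy0 _ trivial_cover); apply: ereal_sup_ubound.
by exists [set [set: X]].
Qed.

(** * Independence and exponential growth *)

Lemma exp2_gt_linear (C : nat) : exists n : nat, ((C * n).+1 < 2 ^ n)%N.
Proof.
(* At [n = 3 * C.+1] the right side is at least the cube of [C.+2], while the
   left side is quadratic in [C]. *)
exists (3 * C.+1)%N; rewrite expnM.
have : (C.+2 ^ 3 <= (2 ^ C.+1) ^ 3)%N by rewrite leq_exp2r// ltn_expl.
have -> : ((2 ^ 3) ^ C.+1 = (2 ^ C.+1) ^ 3)%N by rewrite -!expnM mulnC.
by apply: leq_trans; rewrite !expnS expn0; nia.
Qed.

Lemma circularly_ordered_tame (R : realType) (X : topologicalType)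
    (T : int -> X -> X) :
  is_cascade T -> circularly_ordered T -> tame_system R T.
Proof.
move=> hT hco f fcont [u [uT [a [b [ab indep]]]]].
have [g ug] := choice uT.
pose lo := f @^-1` [set y | y < b]; pose hi := f @^-1` [set y | a < y].
have Ucov : open_cover [set lo; hi].
  split=> [_ [->|->]|].
  - by apply: open_comp; [move=> x _; exact: fcont|exact: open_lt].
  - by apply: open_comp; [move=> x _; exact: fcont|exact: open_gt].
  rewrite -subTset => x _; have [fxb|bfx] := ltP (f x) b.
    by exists lo => //; left.
  by exists hi; [right|exact: lt_le_trans bfx].
have [C CU] := itinerary_code hT hco Ucov.
have [n Cn] := exp2_gt_linear C; have [code code_le codeU] := CU n g.
pose times (P : {set 'I_n}) := [set nat_of_ord i | i in [set` P]].
have times_fin P : finite_set (times P).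
  by apply: finite_image; exact: finite_finset.
have /choice[pt ptP] : forall P : {set 'I_n}, exists x, forall i : 'I_n,
    if i \in P then f (T (g i) x) < a else b < f (T (g i) x).
  move=> P; have disj : times P `&` times (~: P)%SET = set0.
    rewrite -subset0 => _ [[i /= iP <-] [j /= jP /ord_inj ji]].
    by move: jP; rewrite ji inE iP.
  have [x [xlo xhi]] := indep _ _ (times_fin P) (times_fin _) disj.
  exists x => i; case: ifPn => iP.
    by have := xlo i; rewrite ug; apply; exists i.
  by have := xhi i; rewrite ug; apply; exists i => //=; rewrite inE.
pose cell P : 'I_(C * n).+1 :=
  Ordinal (code_le (pt P) : (code (pt P) < (C * n).+1)%N).
have cell_inj : injective cell.
  (* At a time in [P] but not in [Q], the point for [P] is only in [lo] and
     the point for [Q] is only in [hi]. *)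
  have sub P Q : code (pt P) = code (pt Q) -> P \subset Q.
    move=> ePQ; apply/fintype.subsetP => i iP; apply: contraT => iQ.
    have [A UA xA] := codeU (pt P) i (ltn_ord i).
    have AP := xA _ erefl; have AQ := xA _ (esym ePQ).
    have := ptP P i; have := ptP Q i; rewrite iP (negbTE iQ) => fQ fP.
    case: UA => eA; move: AP AQ; rewrite eA /lo /hi /=; lra.
  move=> P Q /(congr1 val) /= ePQ; apply/eqP; rewrite finset.eqEsubset.
  by rewrite !sub.
have := leq_card cell cell_inj.
by rewrite card_ord -cardsT -powersetT card_powerset cardsT card_ord leqNgt Cn.
Qed.

Theorem theorem2p13 (R : realType) (X : topologicalType) (T : int -> X -> X)
    (hT : is_cascade T) (hX : metrizable R X) (hco : circularly_ordered T) :
  null_system R T /\ tame_system R T.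
Proof.
split; first exact: circularly_ordered_null.
exact: circularly_ordered_tame.
Qed.
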